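(* Let $G$ be a simple graph on $n$ vertices and let $k$ be an integer with $3\le k\le n-3$. If $G$ contains a path with $7$ vertices (as a subgraph), then $F_k(G)$ is non-planar.
   Context: For a simple graph $G=(V,E)$ on $n$ vertices and an integer $1\le k<n$, the $k$-token graph $F_k(G)$ is the graph whose vertices are all $k$-element subsets of $V$, two such subsets $A,B$ being adjacent whenever their symmetric difference $A\triangle B$ is a pair $\{a,b\}$ with $a$ adjacent to $b$ in $G$. *)

(* Defs.v *)
From mathcomp Require Import all_boot.
From Stdlib Require Import Reals.
Set Implicit Arguments. Unset Strict Implicit. Unset Printing Implicit Defensive.

Definition simple_graph (T : finType) (e : rel T) : Prop :=
  symmetric e /\ irreflexive e.

Definition token (T : finType) (k : nat) := {A : {set T} | #|A| == k}.

Definition token_adj (T : finType) (e : rel T) (k : nat) : rel (token T k) :=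
  fun A B => [exists a : T, exists b : T,
    e a b && ((val A :\: val B) :|: (val B :\: val A) == [set a; b])].

Definition has_P7 (T : finType) (e : rel T) : Prop :=
  exists p : 'I_7 -> T, injective p /\
    forall i : 'I_7, i.+1 < 7 -> e (p i) (p (inord i.+1)).

Local Open Scope R_scope.

Definition arc (g : R -> R * R) : Prop :=
  (forall t, 0 <= t <= 1 ->
     continuity_pt (fun s => fst (g s)) t /\ continuity_pt (fun s => snd (g s)) t) /\
  (forall s t, 0 <= s <= 1 -> 0 <= t <= 1 -> g s = g t -> s = t).

Definition planar (V : finType) (adj : rel V) : Prop :=
  exists (pos : V -> R * R) (gam : V -> V -> R -> R * R),
    injective pos /\
    (forall u v, adj u v ->
       arc (gam u v) /\ gam u v 0 = pos u /\ gam u v 1 = pos v /\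
       (forall t w, 0 < t < 1 -> gam u v t <> pos w) /\
       (forall u' v', adj u' v' -> ~ ((u' = u /\ v' = v) \/ (u' = v /\ v' = u)) ->
          forall s t, 0 < s < 1 -> 0 < t < 1 -> gam u v s <> gam u' v' t)).

(* Main.v *)
(* A planar drawing cannot contain a subdivision of K_{3,3} because of van
   Kampen's parity argument. For vertex-disjoint edges uv and wz, the vector
   gam_uv(s) - gam_wz(t) never vanishes on the unit square, so modulo 2 its winding
   along the boundary of the square is zero; this relates the windings of uv
   around w, z and those of wz around u, v to the relative positions of the
   endpoints. In K_{3,3} with sides a_i and b_j, summing the relations of the pairs
   a_i b_j, a_i' b_j' with j <> j' shows that the bit A_i, the total winding of the
   edges at a_i around the other b_j, differs from A_i'; three bits cannot be
   pairwise distinct. The graph F_3(P_7) contains a subdivision of K_{3,3}; fixing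
   k - 3 tokens outside the path embeds it in F_k(G) when k <= n - 4, and
   complementation F_3(G) -> F_(n-3)(G) covers the remaining value k = n - 3. *)
From Stdlib Require Import Reals Lra Ring Classical ClassicalEpsilon.
From Coquelicot Require Compactness.
Require Import Defs.
From mathcomp Require Import all_boot.
Set Implicit Arguments. Unset Strict Implicit. Unset Printing Implicit Defensive.

(** * Arithmetic of parities *)

Lemma addb_ring : ring_theory false true addb andb addb (fun b => b) (@eq bool).
Proof. by split; do ?case. Qed.

Lemma eqb_eq_true (x y : bool) : eqb x y = true -> x = y.
Proof. by move/eqP. Qed.

Ltac bool_cst b := match b with true => constr:(true) | false => constr:(false)
  | _ => constr:(NotConstant) end.
Add Ring addb_ring : addb_ring (decidable eqb_eq_true, constants [bool_cst]).

Lemma big_addb_telescope (f : nat -> bool) n :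
  \big[addb/false]_(i < n) (f i (+) f i.+1) = f 0 (+) f n.
Proof.
elim: n => [|n IHn]; first by rewrite big_ord0 addbb.
by rewrite big_ord_recr /= IHn; ring.
Qed.

(** Serves to give the finitely many pairs of edges one common number of sample points. *)
Lemma uniformly_eventually (I : finType) (P : I -> nat -> Prop) :
  (forall i, exists N0, forall N, N0 <= N -> P i N) -> exists N, forall i, P i N.
Proof.
case/fin_all_exists => N0 hN0; exists (\max_i N0 i) => i.
exact: hN0 (leq_bigmax i).
Qed.

(** * Crossing parities of polygonal curves *)

Section Crossings.

Local Open Scope R_scope.

Definition vsub (P Q : R * R) : R * R := (fst P - fst Q, snd P - snd Q).

Definition right_side (P : R * R) : bool := Rlt_dec 0 (fst P).

(* The tie-break on the horizontal axis makes [upper] flip under every nonzero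
   [P -> - P]. *)
Definition upper (P : R * R) : bool :=
  if Req_dec_T (snd P) 0 then right_side P else Rlt_dec 0 (snd P).

(* For nearby points, the parity of the crossings of the segment [P, Q] with the
   positive horizontal half-axis. *)
Definition crossing (P Q : R * R) : bool :=
  (upper P (+) upper Q) && right_side P.

(** These four open half-planes cover the punctured plane, so a small set of vectors away from the
    origin fits into one of them. *)
Definition one_sided (S : R * R -> Prop) : Prop :=
  (forall P, S P -> 0 < fst P) \/ (forall P, S P -> fst P < 0) \/
  (forall P, S P -> 0 < snd P) \/ (forall P, S P -> snd P < 0).

Lemma one_sided_sub (S S' : R * R -> Prop) :
  (forall P, S' P -> S P) -> one_sided S -> one_sided S'.
Proof.
move=> sub [h|[h|[h|h]]]; [left|right; left|right; right; left|right; right; right];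
  by move=> P /sub /h.
Qed.

Lemma upper_vsubC (P Q : R * R) : P <> Q -> upper (vsub Q P) = ~~ upper (vsub P Q).
Proof.
case: P Q => [p1 p2] [q1 q2] neq; rewrite /upper /right_side /=.
do ![case: Req_dec_T => ?]; do ![case: Rlt_dec => ?] => //=; try lra.
by case: neq; congr pair; lra.
Qed.

(** On the right half-plane [crossing] is the difference of [upper] at the two ends, so both sides
    add up [upper] over the four corners. On the other half-planes every term vanishes. *)
Lemma one_sided_square S P Q P' Q' :
  one_sided S -> S P -> S Q -> S P' -> S Q' ->
  crossing P Q (+) crossing P' Q' = crossing P P' (+) crossing Q Q'.
Proof.
rewrite /crossing /upper /right_side => oS SP SQ SP' SQ'.
case: oS => [h|[h|[h|h]]]; move: (h _ SP) (h _ SQ) (h _ SP') (h _ SQ') => hP hQ hP' hQ'.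
- do ![case: (Rlt_dec 0 (fst _)) => ?; try lra].
  by rewrite !andbT /=; ring.
- do ![case: (Rlt_dec 0 (fst _)) => ?; try lra].
  by rewrite !andbF.
- do ![case: (Rlt_dec 0 (snd _)) => ?; try lra].
  by do ![case: (Req_dec_T (snd _) 0) => ?; try lra].
- do ![case: (Rlt_dec 0 (snd _)) => ?; try lra].
  by do ![case: (Req_dec_T (snd _) 0) => ?; try lra].
Qed.

(** Negation flips [upper] at both ends and so keeps their sum. If the sum is true, the vectors lie
    strictly left or right of the vertical axis and negation flips [right_side]; otherwise all terms
    vanish. *)
Lemma one_sided_crossingN S P Q P' Q' :
  one_sided S -> S (vsub P P') -> S (vsub Q Q') ->
  crossing (vsub P' P) (vsub Q' Q) =
  crossing (vsub P P') (vsub Q Q') (+) (upper (vsub P P') (+) upper (vsub Q Q')).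
Proof.
move=> oS SP SQ.
have neP : P <> P'.
  by move=> eP; subst P'; case: oS => [h|[h|[h|h]]]; move: (h _ SP) => /=; lra.
have neQ : Q <> Q'.
  by move=> eP; subst Q'; case: oS => [h|[h|[h|h]]]; move: (h _ SQ) => /=; lra.
rewrite /crossing (upper_vsubC neP) (upper_vsubC neQ).
case: oS => [h|[h|[h|h]]]; move: (h _ SP) (h _ SQ) => /= hP hQ.
- rewrite /right_side /=; do ![case: (Rlt_dec 0 _) => ? /=; try lra].
  by do 2 case: upper.
- rewrite /right_side /=; do ![case: (Rlt_dec 0 _) => ? /=; try lra].
  by do 2 case: upper.
- rewrite /upper /=; do ![case: (Rlt_dec 0 (snd _ - _)) => ? /=; try lra].
  by do ![case: (Req_dec_T (snd _ - _) 0) => ? /=; try lra].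
- rewrite /upper /=; do ![case: (Rlt_dec 0 (snd _ - _)) => ? /=; try lra].
  by do ![case: (Req_dec_T (snd _ - _) 0) => ? /=; try lra].
Qed.

Definition winding (N : nat) (E : nat -> R * R) (Q : R * R) : bool :=
  \big[addb/false]_(i < N) crossing (vsub (E i) Q) (vsub (E i.+1) Q).

(** The crossings around each cell of the grid of vectors [E i - F j] cancel, which leaves the
    boundary of the grid. On the sides where [F] runs, the vectors must be negated to give windings
    of [F]; this produces the [upper] terms. *)
Lemma winding_exchange (N : nat) (E F : nat -> R * R) :
  (0 < N)%N ->
  (forall i j, (i < N)%N -> (j < N)%N -> exists2 S, one_sided S &
     forall i' j', (i <= i' <= i.+1)%N -> (j <= j' <= j.+1)%N ->
       S (vsub (E i') (F j'))) ->
  winding N E (F 0%N) (+) winding N E (F N) (+) winding N F (E 0%N) (+) winding N F (E N)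
  = upper (vsub (E 0%N) (F 0%N)) (+) upper (vsub (E 0%N) (F N))
    (+) upper (vsub (E N) (F 0%N)) (+) upper (vsub (E N) (F N)).
Proof.
move=> N0 cell.
pose v i j := crossing (vsub (E i) (F j)) (vsub (E i) (F j.+1)).
have row j : (j < N)%N -> winding N E (F j) (+) winding N E (F j.+1) = v 0%N j (+) v N j.
  move=> jN; rewrite -(big_addb_telescope (fun i => v i j)) -big_split /=.
  apply: eq_bigr => i _; have [S oS hS] := cell i j (ltn_ord i) jN.
  by apply: one_sided_square oS _ _ _ _; apply: hS; rewrite ?leqnn ?leqnSn.
have col i : (i <= N)%N -> \big[addb/false]_(j < N) v i j
    = winding N F (E i) (+) (upper (vsub (E i) (F 0%N)) (+) upper (vsub (E i) (F N))).
  move=> iN; rewrite -(big_addb_telescope (fun j => upper (vsub (E i) (F j)))) -big_split /=.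
  apply: eq_bigr => j _.
  have [S oS hS] : exists2 S, one_sided S &
      forall j', (j <= j' <= j.+1)%N -> S (vsub (E i) (F j')).
    case: (ltnP i N) => [iN'|Ni].
      have [S oS hS] := cell i j iN' (ltn_ord j).
      by exists S => // j' ?; apply: hS; rewrite // leqnn leqnSn.
    (* The line [i = N] starts no cell; it is the far side of the cells with index [N.-1]. *)
    have ei : i = N.-1.+1 by rewrite prednK //; apply/eqP; rewrite eqn_leq iN Ni.
    have [|S oS hS] := cell N.-1 j _ (ltn_ord j); first by rewrite prednK.
    by exists S => // j' ?; apply: hS; rewrite // ei leqnn leqnSn.
  have hj := hS j; have hj1 := hS j.+1; rewrite !leqnn !leqnSn in hj hj1.
  by rewrite (one_sided_crossingN oS (hj isT) (hj1 isT)) /v; ring.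
have := big_addb_telescope (fun j => winding N E (F j)) N.
rewrite (eq_bigr _ (fun (j : 'I_N) _ => row j (ltn_ord j))).
rewrite big_split /= !col // => <-; ring.
Qed.


(** * Uniform separation of disjoint curves *)

Lemma continuity_pt_near (f : R -> R) (x eps : R) :
  continuity_pt f x -> 0 < eps ->
  exists2 d, 0 < d & forall y, Rabs (y - x) < d -> Rabs (f y - f x) < eps.
Proof.
move=> fx eps0; have [d [d0 hd]] := fx eps eps0; exists d => // y yx.
case: (Req_dec_T x y) => [<-|neq]; first by rewrite Rminus_diag Rabs_R0.
exact: hd y (conj (conj I neq) yx).
Qed.

(** Some coordinate of [g u - h v] is nonzero, and it keeps its sign while each curve moves by less
    than half its absolute value. *)
Lemma one_sided_near (g h : R -> R * R) (u v : R) :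
  continuity_pt (fun s => fst (g s)) u -> continuity_pt (fun s => snd (g s)) u ->
  continuity_pt (fun s => fst (h s)) v -> continuity_pt (fun s => snd (h s)) v ->
  g u <> h v ->
  exists d : posreal, one_sided (fun P => exists s t,
    [/\ Rabs (s - u) < d, Rabs (t - v) < d & P = vsub (g s) (h t)]).
Proof.
have near f1 f2 : continuity_pt f1 u -> continuity_pt f2 v -> f1 u <> f2 v ->
  exists d : posreal,
    (forall s t, Rabs (s - u) < d -> Rabs (t - v) < d -> 0 < f1 s - f2 t) \/
    (forall s t, Rabs (s - u) < d -> Rabs (t - v) < d -> f1 s - f2 t < 0).
  move=> c1 c2 neq.
  have eps0 : 0 < Rabs (f1 u - f2 v) / 2.
    by have := Rabs_pos_lt (f1 u - f2 v); lra.
  have [d1 d10 h1] := continuity_pt_near c1 eps0.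
  have [d2 d20 h2] := continuity_pt_near c2 eps0.
  exists (mkposreal _ (Rmin_pos _ _ d10 d20)) => /=.
  have [ml mr] := (Rmin_l d1 d2, Rmin_r d1 d2).
  case: (Rlt_dec 0 (f1 u - f2 v)) => sg; [left|right] => s t su tv.
    have /Rabs_def2 := h1 s ltac:(lra); have /Rabs_def2 := h2 t ltac:(lra).
    by rewrite (Rabs_pos_eq (f1 u - f2 v)); lra.
  have /Rabs_def2 := h1 s ltac:(lra); have /Rabs_def2 := h2 t ltac:(lra).
  by rewrite (Rabs_left1 (f1 u - f2 v)); lra.
move=> g1 g2 h1 h2 neq.
case: (Req_dec_T (fst (g u)) (fst (h v))) => [e1|ne1].
  have ne2 : snd (g u) <> snd (h v).
    move=> e2; apply: neq.
    by rewrite (surjective_pairing (g u)) (surjective_pairing (h v)) e1 e2.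
  have [d hd] := near _ _ g2 h2 ne2; exists d.
  by case: hd => hd; do 2 right; [left|right] => _ [s [t [su tv ->]]]; apply: hd.
have [d hd] := near _ _ g1 h1 ne1; exists d.
by case: hd => hd; [left|right; left] => _ [s [t [su tv ->]]]; apply: hd.
Qed.

(** Compactness of the unit square turns the pointwise radii into a uniform one, as with a Lebesgue
    number. *)
Lemma disjoint_curves_one_sided (g h : R -> R * R) :
  (forall t, 0 <= t <= 1 ->
     continuity_pt (fun s => fst (g s)) t /\ continuity_pt (fun s => snd (g s)) t) ->
  (forall t, 0 <= t <= 1 ->
     continuity_pt (fun s => fst (h s)) t /\ continuity_pt (fun s => snd (h s)) t) ->
  (forall s t, 0 <= s <= 1 -> 0 <= t <= 1 -> g s <> h t) ->
  exists2 d, 0 < d & forall x y, 0 <= x <= 1 -> 0 <= y <= 1 ->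
    one_sided (fun P => exists s t,
      [/\ Rabs (s - x) < d, Rabs (t - y) < d & P = vsub (g s) (h t)]).
Proof.
move=> cg ch disj.
have near : forall uv : R * R, exists d : posreal,
    0 <= fst uv <= 1 -> 0 <= snd uv <= 1 -> one_sided (fun P => exists s t,
    [/\ Rabs (s - fst uv) < d, Rabs (t - snd uv) < d & P = vsub (g s) (h t)]).
  move=> [u v] /=.
  case: (classic (0 <= u <= 1 /\ 0 <= v <= 1)) => [[hu hv]|n].
    have [[g1 g2] [h1 h2]] := (cg u hu, ch v hv).
    have [d hd] := one_sided_near g1 g2 h1 h2 (disj u v hu hv).
    by exists d.
  (* Outside the square the radius 1 is a dummy value. *)
  by exists (mkposreal 1 Rlt_0_1) => hu hv; case: n.
have cid uv := constructive_indefinite_description _ (near uv).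
have [delta0 hdelta0] : exists delta0, forall uv, delta0 uv = proj1_sig (cid uv) by eexists.
(* With halved radii, a [d]-neighbourhood of [(x, y)] still lies within the full radius around
   [(u, v)]. *)
have half (r : posreal) : 0 < r / 2 by have := cond_pos r; lra.
pose delta u v := mkposreal _ (half (delta0 (u, v))).
have [d hd] := Compactness.compactness_value_2d 0 1 0 1 delta.
exists d; first exact: cond_pos.
move=> x y hx hy; have /NNPP [u [v [hu [hv [xu [yv dd]]]]]] := hd x y hx hy.
apply: one_sided_sub (proj2_sig (cid (u, v)) hu hv) => _ [s [t [sx ty ->]]].
rewrite -hdelta0 /= in xu yv dd *.
exists s, t; split=> //.
  by have := Rabs_triang (s - x) (x - u); rewrite (_ : s - x + (x - u) = s - u); lra.
by have := Rabs_triang (t - y) (y - v); rewrite (_ : t - y + (y - v) = t - v); lra.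
Qed.

(** * Sampled curves and the parity relation of a drawing *)

Definition sample (g : R -> R * R) (N i : nat) : R * R := g (INR i / INR N).

Lemma sample0 g N : sample g N 0%N = g 0.
Proof. by rewrite /sample /Rdiv Rmult_0_l. Qed.

Lemma sample_last g N : (0 < N)%N -> sample g N N = g 1.
Proof. by move=> /ltP /lt_0_INR N0; rewrite /sample Rdiv_diag //; lra. Qed.

(** Once the mesh [1 / N] is below the uniform radius, each grid cell is one-sided. *)
Lemma winding_exchange_curves (g h : R -> R * R) :
  (forall t, 0 <= t <= 1 ->
     continuity_pt (fun s => fst (g s)) t /\ continuity_pt (fun s => snd (g s)) t) ->
  (forall t, 0 <= t <= 1 ->
     continuity_pt (fun s => fst (h s)) t /\ continuity_pt (fun s => snd (h s)) t) ->
  (forall s t, 0 <= s <= 1 -> 0 <= t <= 1 -> g s <> h t) ->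
  exists N0, forall N, (N0 <= N)%N ->
    winding N (sample g N) (h 0) (+) winding N (sample g N) (h 1)
    (+) winding N (sample h N) (g 0) (+) winding N (sample h N) (g 1)
    = upper (vsub (g 0) (h 0)) (+) upper (vsub (g 0) (h 1))
      (+) upper (vsub (g 1) (h 0)) (+) upper (vsub (g 1) (h 1)).
Proof.
move=> cg ch disj; have [d d0 hd] := disjoint_curves_one_sided cg ch disj.
have [N0 [hN0 N00]] := archimed_cor1 d d0.
exists N0 => N /leP leN.
have N0R : 0 < INR N0 by exact: lt_0_INR.
have NR := le_INR _ _ leN.
have hN : / INR N < d by have := Rinv_le_contravar _ _ N0R NR; lra.
have iN0 : 0 < / INR N by apply: Rinv_0_lt_compat; lra.
have Npos : (0 < N)%N by apply/ltP/INR_lt; rewrite /=; lra.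
have unit i : (i < N)%N -> 0 <= INR i / INR N <= 1.
  move=> /ltP /Nat.lt_le_incl /le_INR iN; have i0 := pos_INR i; split.
    by apply: Rmult_le_pos; lra.
  by apply: (Rmult_le_reg_r (INR N)); [lra|rewrite /Rdiv Rmult_assoc Rinv_l; lra].
have close i i' : (i <= i' <= i.+1)%N -> Rabs (INR i' / INR N - INR i / INR N) < d.
  move=> /andP [/leP /le_INR l1 /leP /le_INR]; rewrite S_INR => l2.
  rewrite -Rmult_minus_distr_r Rabs_pos_eq; last by apply: Rmult_le_pos; lra.
  by apply: Rle_lt_trans hN; have := Rmult_le_compat_r (/ INR N) (INR i' - INR i) 1; lra.
have := @winding_exchange N (sample g N) (sample h N) Npos.
rewrite !sample0 !(sample_last _ Npos); apply=> i j iN jN.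
eexists; first exact: hd (unit i iN) (unit j jN).
by move=> i' j' hi hj; exists (INR i' / INR N), (INR j' / INR N); split=> //; apply: close.
Qed.

(* [theta u v w] is the parity of the winding of the edge [uv] around [w], and
   [up u v] tells whether [u] lies above [v]. *)
Lemma planar_parity (V : finType) (adj : rel V) : planar adj ->
  exists (theta : V -> V -> V -> bool) (up : V -> V -> bool),
    (forall u v, u != v -> up v u = ~~ up u v) /\
    (forall u v w z, adj u v -> adj w z -> u != w -> u != z -> v != w -> v != z ->
       theta u v w (+) theta u v z (+) theta w z u (+) theta w z v
       = up u w (+) up u z (+) up v w (+) up v z).
Proof.
case=> pos [gam [pos_inj hgam]].
pose theta N u v w := winding N (sample (gam u v) N) (pos w).
pose up u v := upper (vsub (pos u) (pos v)).
have [N hN] : exists N, forall x : (V * V) * (V * V),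
    let: ((u, v), (w, z)) := x in
    adj u v -> adj w z -> u != w -> u != z -> v != w -> v != z ->
    theta N u v w (+) theta N u v z (+) theta N w z u (+) theta N w z v
    = up u w (+) up u z (+) up v w (+) up v z.
  apply: uniformly_eventually => -[[u v] [w z]].
  case: (boolP [&& adj u v, adj w z, u != w, u != z, v != w & v != z]); last first.
    by move=> n; exists 0%N => N _ ? ? ? ? ? ?; case/negP: n; apply/and5P; split => //; apply/andP.
  case/and5P=> uv wz /eqP uw /eqP uz /andP [/eqP vw /eqP vz].
  have [[[cg _] [g0 [g1 [gpos gdisj]]]] [[ch _] [h0 [h1 [hpos _]]]]] := (hgam _ _ uv, hgam _ _ wz).
  have inner (x : R) : (0 <= x <= 1) -> x = 0 \/ x = 1 \/ (0 < x < 1).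
    by move=> [[x0|<-] [x1|->]]; tauto.
  (* End against end uses injectivity of [pos], end against interior that no edge passes through a
     vertex, and interior against interior that edges do not cross. *)
  have disj s t : (0 <= s <= 1) -> (0 <= t <= 1) -> gam u v s <> gam w z t.
    move=> /inner [->|[->|hs]] /inner [->|[->|ht]]; rewrite ?g0 ?g1 ?h0 ?h1.
    - by move/pos_inj.
    - by move/pos_inj.
    - by move/esym; apply: hpos.
    - by move/pos_inj.
    - by move/pos_inj.
    - by move/esym; apply: hpos.
    - exact: gpos.
    - exact: gpos.
    - by apply: gdisj => //; case=> -[wu zv]; [apply: uw | apply: uz].
  have [N0 hN0] := winding_exchange_curves cg ch disj.
  exists N0 => N /hN0; rewrite g0 g1 h0 h1 => e _ _ _ _ _ _; exact: e.
exists (theta N), up; split; last by move=> u v w z; exact: hN ((u, v), (w, z)).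
by move=> u v /eqP uv; apply: upper_vsubC => /pos_inj.
Qed.

End Crossings.

(** * Walks and subdivisions of K_{3,3} *)

Fixpoint walk_parity (V : Type) (theta : V -> V -> V -> bool) (x : V) (p : seq V) (w : V) :=
  if p is y :: p' then theta x y w (+) walk_parity theta y p' w else false.

(** The relation is additive under concatenation, since terms at an intermediate vertex occur twice.
    Induction extends first one edge to a walk, then the other. *)
Lemma walk_parity_exchange (V : eqType) (adj : rel V)
    (theta : V -> V -> V -> bool) (up : V -> V -> bool) :
  (forall u v w z, adj u v -> adj w z -> u != w -> u != z -> v != w -> v != z ->
     theta u v w (+) theta u v z (+) theta w z u (+) theta w z v
     = up u w (+) up u z (+) up v w (+) up v z) ->
  forall x p y q, path adj x p -> path adj y q -> ~~ has [in x :: p] (y :: q) ->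
    walk_parity theta x p y (+) walk_parity theta x p (last y q)
    (+) walk_parity theta y q x (+) walk_parity theta y q (last x p)
    = up x y (+) up x (last y q) (+) up (last x p) y (+) up (last x p) (last y q).
Proof.
move=> edges.
have edge_walk u v y q : adj u v -> path adj y q -> ~~ has [in [:: u; v]] (y :: q) ->
    theta u v y (+) theta u v (last y q)
    (+) walk_parity theta y q u (+) walk_parity theta y q v
    = up u y (+) up u (last y q) (+) up v y (+) up v (last y q).
  move=> uv; elim: q y => [|z q IHq] y /=; first by move=> _ _; ring.
  case/andP=> yz zq /norP [yn dis]; have IH := IHq z zq dis.
  case/norP: dis => zn _.
  move: yn zn; rewrite !inE !negb_or !(eq_sym _ u) !(eq_sym _ v) => /andP [uy vy] /andP [uz vz].
  have := edges _ _ _ _ uv yz uy uz vy vz.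
  move: IH; set a := last z q => IH e.
  transitivity ((theta u v y (+) theta u v z (+) theta y z u (+) theta y z v) (+)
    (theta u v z (+) theta u v a (+) walk_parity theta z q u (+) walk_parity theta z q v)).
    by ring.
  by rewrite IH e; ring.
move=> x p y q; elim: p x => [|z p IHp] x; first by move=> _ _ _ /=; ring.
rewrite [path _ _ (_ :: _)]/= => /andP [xz zp] yq dis.
have sub (s : seq V) : {subset s <= [:: x, z & p]} -> ~~ has [in s] (y :: q).
  move=> ss; apply: contra dis => /hasP [t tq ts]; apply/hasP; exists t => //; exact: ss.
have IH := IHp z zp yq (sub (z :: p) (fun t ht => mem_behead (s := [:: x, z & p]) ht)).
have e := edge_walk x z y q xz yq (sub [:: x; z] _).
rewrite /=; move: IH e; set a := last z p; set b := last y q => IH e.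
transitivity ((theta x z y (+) theta x z b (+) walk_parity theta y q x (+) walk_parity theta y q z)
  (+) (walk_parity theta z p y (+) walk_parity theta z p b (+) walk_parity theta y q z
       (+) walk_parity theta y q a)); first by ring.
rewrite IH e; first by ring.
by move=> t; rewrite !inE => /orP [] /eqP ->; rewrite eqxx ?orbT.
Qed.

(* The paths [P i j] from [a i] to [b j] need only be disjoint when they
   subdivide nonadjacent edges of K_{3,3}. *)
Lemma K33_subdivision_nonplanar (V : finType) (adj : rel V)
    (a b : nat -> V) (P : nat -> nat -> seq V) :
  (forall i j, i < 3 -> j < 3 -> path adj (a i) (P i j)) ->
  (forall i j, i < 3 -> j < 3 -> last (a i) (P i j) = b j) ->
  (forall i i' j j', i < 3 -> i' < 3 -> j < 3 -> j' < 3 -> i != i' -> j != j' ->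
     ~~ has [in a i :: P i j] (a i' :: P i' j')) ->
  ~ planar adj.
Proof.
move=> pathP lastP disP /planar_parity [theta [up [upC edges]]].
pose t i j w := walk_parity theta (a i) (P i j) w.
have exch i i' j j' : i < 3 -> i' < 3 -> j < 3 -> j' < 3 -> i != i' -> j != j' ->
    t i j (a i') (+) t i j (b j') (+) t i' j' (a i) (+) t i' j' (b j)
    = up (a i) (a i') (+) up (a i) (b j') (+) up (b j) (a i') (+) up (b j) (b j').
  move=> hi hi' hj hj' ni nj.
  have := walk_parity_exchange edges (pathP i j hi hj) (pathP i' j' hi' hj')
    (disP _ _ _ _ hi hi' hj hj' ni nj).
  by rewrite !lastP.
have neqb j j' : j < 3 -> j' < 3 -> j != j' -> b j != b j'.
  move=> hj hj' nj; have := disP 0 1 j j' isT isT hj hj' isT nj.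
  rewrite -(lastP 0 j) // -(lastP 1 j') //; apply: contra => /eqP e.
  by apply/hasP; exists (last (a 1) (P 1 j')); rewrite ?mem_last // -e mem_last.
pose A i := t i 0 (b 1) (+) t i 0 (b 2) (+) t i 1 (b 0) (+) t i 1 (b 2)
            (+) t i 2 (b 0) (+) t i 2 (b 1).
have neqA i i' : i < 3 -> i' < 3 -> i != i' -> A i (+) A i' = true.
  move=> hi hi' ni.
  have e01 := exch i i' 0 1 hi hi' isT isT ni isT.
  have e02 := exch i i' 0 2 hi hi' isT isT ni isT.
  have e10 := exch i i' 1 0 hi hi' isT isT ni isT.
  have e12 := exch i i' 1 2 hi hi' isT isT ni isT.
  have e20 := exch i i' 2 0 hi hi' isT isT ni isT.
  have e21 := exch i i' 2 1 hi hi' isT isT ni isT.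
  (* In the sum of the six relations, every term at [a i] or [a i'] occurs an even number of times.
     The three pairs of opposite [up] comparisons among the [b j] contribute true each, hence true
     in total. *)
  rewrite (upC (b 0) (b 1)) ?neqb // -addTb in e10.
  rewrite (upC (b 0) (b 2)) ?neqb // -addTb in e20.
  rewrite (upC (b 1) (b 2)) ?neqb // -addTb in e21.
  move: (congr2 addb (congr2 addb (congr2 addb e01 e02) (congr2 addb e10 e12))
    (congr2 addb e20 e21)).
  match goal with |- ?L = ?R -> _ => move=> e; transitivity (L (+) R (+) true) end.
    by rewrite /A; ring.
  by rewrite e addbb.
have := neqA 0 1 isT isT isT; have := neqA 1 2 isT isT isT; have := neqA 0 2 isT isT isT.
by case: (A 0); case: (A 1); case: (A 2).
Qed.

(** * A subdivision of K_{3,3} among triples on the path *)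

(** A list stands for the set of its entries below 7, so order and repetition are immaterial and all
    checks can be computed. *)
Definition config (s : seq nat) : bool := count [in s] (iota 0 7) == 3.

Definition config_adj (s t : seq nat) : bool :=
  has (fun i => all (fun j => (j \in s) (+) (j \in t) == (j \in [:: i; i.+1]))
                    (iota 0 7)) (iota 0 6).

Definition config_neq (s t : seq nat) : bool :=
  has (fun j => (j \in s) != (j \in t)) (iota 0 7).

(* Inside [F_3(P_7)], the triples [x :: l] with [x] in the path 0 - 1 - 2 and [l]
   in the star with centre 35 and leaves 36, 45, 34 form a P_3 x K_{1,3}, which
   contains a subdivision of K_{3,3}: join [x :: centre] to [1 :: leaf] through
   [x :: leaf]. *)
Lemma triples_of_P7_nonplanar (V : finType) (adj : rel V) (F : seq nat -> V) :
  (forall s t, config s -> config t -> config_adj s t -> adj (F s) (F t)) ->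
  (forall s t, config s -> config t -> config_neq s t -> F s != F t) ->
  ~ planar adj.
Proof.
move=> Fadj Fneq.
pose leaf j := nth [::] [:: [:: 3; 6]; [:: 4; 5]; [:: 3; 4]] j.
pose a i := [:: i; 3; 5]; pose b j := 1 :: leaf j.
(* For [i = 1] the triple [i :: leaf j] is already [b j], so the path is a single edge. *)
pose P i j := if i == 1 then [:: b j] else [:: i :: leaf j; b j].
have config_all : all (fun i => all (fun j => all config (a i :: P i j)) (iota 0 3)) (iota 0 3).
  by vm_compute.
have path_all : all (fun i => all (fun j => path config_adj (a i) (P i j)) (iota 0 3)) (iota 0 3).
  by vm_compute.
have disj_all : all (fun i => all (fun i' => all (fun j => all (fun j' =>
    (i != i') && (j != j') ==> allrel config_neq (a i :: P i j) (a i' :: P i' j'))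
    (iota 0 3)) (iota 0 3)) (iota 0 3)) (iota 0 3).
  by vm_compute.
have mem3 i : i < 3 -> i \in iota 0 3 by rewrite mem_iota.
have configP i j : i < 3 -> j < 3 -> all config (a i :: P i j).
  by move=> /mem3 hi /mem3 hj; exact: (allP (allP config_all i hi) j hj).
apply: (@K33_subdivision_nonplanar _ _ (F \o a) (F \o b) (fun i j => map F (P i j))).
- move=> i j hi hj; apply: (homo_path_in (P := config) (e := config_adj)).
  + by move=> s t hs ht; apply: Fadj.
  + exact: configP.
  + exact: (allP (allP path_all i (mem3 i hi)) j (mem3 j hj)).
- by move=> i j _ _; rewrite /= last_map /P; case: ifP.
- move=> i i' j j' hi hi' hj hj' ni nj; apply/hasPn => y.
  rewrite -[_ :: _]/(map F (a i' :: P i' j')) => /mapP [t ht ->].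
  rewrite -[_ :: _]/(map F (a i :: P i j)); apply/mapP => -[s hs].
  have cs := allP (configP i j hi hj) s hs.
  have ct := allP (configP i' j' hi' hj') t ht.
  have := allP (allP (allP (allP disj_all i (mem3 i hi)) i' (mem3 i' hi')) j (mem3 j hj))
    j' (mem3 j' hj').
  rewrite ni nj => /allrelP /(_ s t hs ht) /(Fneq s t cs ct) /eqP neq e.
  exact: neq.
Qed.

(** * Embedding the triples in token graphs *)

(** The other [k - 3] tokens rest on fixed vertices [r] off the path; the bound on [k] makes room
    for them among the [#|T| - 7] such vertices. *)
Lemma token_triples (T : finType) (e : rel T) (k : nat) :
  3 <= k -> k <= #|T| - 4 -> has_P7 e ->
  exists F : seq nat -> token T k,
    (forall s t, config s -> config t -> config_adj s t -> token_adj e (F s) (F t)) /\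
    (forall s t, config s -> config t -> config_neq s t -> F s != F t).
Proof.
move=> k3 kT [p [p_inj pe]].
have /card_geqP [r [r_uniq r_size r_sub]] : k - 3 <= #|~: (p @: [set: 'I_7])|.
  rewrite cardsCs setCK card_imset // cardsT card_ord.
  by apply: leq_trans (leq_sub2r 3 kT) _; rewrite -subnDA.
have r_out i : p i \notin r.
  by apply/negP => /r_sub; rewrite inE imset_f.
pose S (s : seq nat) := [set i : 'I_7 | val i \in s].
pose A s := (p @: S s) :|: [set x in r].
have memA s i : (p i \in A s) = (val i \in s).
  by rewrite !inE (negPf (r_out i)) orbF mem_imset // inE.
have memAr s x : x \notin codom p -> (x \in A s) = (x \in r).
  move=> xp; rewrite !inE; case: imsetP => // -[i _ xi].
  by rewrite xi codom_f in xp.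
have cardA s : config s -> #|A s| == k.
  move=> /eqP cs; rewrite cardsU (_ : _ :&: _ = set0); last first.
    apply/setP => x; rewrite !inE; apply/negP => /andP [/imsetP [i _ ->]].
    by rewrite (negPf (r_out i)).
  rewrite cards0 subn0 card_imset // [X in _ + X]cardsE (card_uniqP r_uniq) r_size.
  suff -> : #|S s| = 3 by rewrite subnKC.
  rewrite -[RHS]cs -val_enum_ord count_map cardE enumT size_filter.
  by apply: eq_count => i; rewrite /= inE.
have s0 : config [:: 0; 1; 2] by [].
(* Lists that are not configurations get an arbitrary default token set. *)
pose F s : token T k := insubd (exist _ (A [:: 0; 1; 2]) (cardA _ s0)) (A s).
have valF s : config s -> val (F s) = A s by move=> cs; rewrite val_insubd cardA.
exists F; split=> s t cs ct.
  case/hasP=> i; rewrite mem_iota => /andP [_ i6] /allP st.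
  have i7 : i < 7 by apply: leq_trans i6 _.
  apply/existsP; exists (p (Ordinal i7)); apply/existsP; exists (p (inord i.+1)).
  rewrite pe //= !valF //; apply/eqP/setP => x.
  rewrite in_setU !in_setD in_set2.
  case: (boolP (x \in codom p)) => [/codomP [j ->{x}]|xp].
    have /eqP := st (val j) ltac:(by rewrite mem_iota ltn_ord).
    rewrite !memA !(inj_eq p_inj) -!val_eqE /= inordK // !inE => <-.
    by do 2 case: (_ \in _).
  rewrite !memAr // orbb andNb; apply/esym/negbTE; rewrite negb_or.
  by apply/andP; split; apply: contraNneq xp => ->; exact: codom_f.
case/hasP=> j; rewrite mem_iota => /andP [_ j7]; apply: contraNneq => eF.
by rewrite -(memA s (Ordinal j7)) -(memA t (Ordinal j7)) -!valF // eF.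
Qed.

Lemma setC_card_token (T : finType) (k k' : nat) (A : token T k) :
  k + k' = #|T| -> #|~: val A| == k'.
Proof.
by move=> kk'; rewrite cardsCs setCK (eqP (valP A)) -kk' addKn.
Qed.

Definition token_compl (T : finType) (k k' : nat) (kk' : k + k' = #|T|)
    (A : token T k) : token T k' := exist _ (~: val A) (setC_card_token A kk').

Lemma token_compl_inj (T : finType) (k k' : nat) (kk' : k + k' = #|T|) :
  injective (token_compl kk').
Proof. by move=> A B /(congr1 val) /setC_inj /val_inj. Qed.

(** Two sets and their complements have the same symmetric difference. *)
Lemma token_adj_compl (T : finType) (e : rel T) (k k' : nat) (kk' : k + k' = #|T|)
    (A B : token T k) :
  token_adj e A B -> token_adj e (token_compl kk' A) (token_compl kk' B).
Proof.
case/existsP=> a /existsP [b /andP [eab /eqP eAB]].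
apply/existsP; exists a; apply/existsP; exists b; rewrite eab -eAB /=.
by rewrite !setDE !setCK setUC ![val _ :&: _]setIC; apply/eqP.
Qed.

Theorem theorem8 (T : finType) (e : rel T) (k : nat) :
  simple_graph e -> 3 <= k -> k <= #|T| - 3 -> has_P7 e ->
  ~ planar (@token_adj T e k).
Proof.
move=> _ k3 kT P7.
have T7 : 7 <= #|T|.
  by have [p [p_inj _]] := P7; rewrite -(card_ord 7); exact: leq_card p_inj.
have [k4|k4] := leqP k (#|T| - 4).
  have [F [Fadj Fneq]] := token_triples k3 k4 P7.
  exact: triples_of_P7_nonplanar Fadj Fneq.
have k4' : 3 <= #|T| - 4 by rewrite leq_subRL // (leq_trans _ T7).
have [F [Fadj Fneq]] := token_triples (leqnn 3) k4' P7.
(* The remaining case is exactly [k = #|T| - 3], where complements of triples are the [k]-sets. *)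
have kk' : 3 + k = #|T|.
  apply/eqP; rewrite eqn_leq -leq_subRL ?kT ?(leq_trans _ T7) //=.
  by rewrite -leq_subLR -ltnS; move: k4; rewrite -[4]/(3 + 1) subnDA subn1; case: (_ - 3).
apply: (@triples_of_P7_nonplanar _ _ (token_compl kk' \o F)) => s t cs ct st.
  exact/token_adj_compl/Fadj.
by rewrite (inj_eq (@token_compl_inj _ _ _ kk')) Fneq.
Qed.
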